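(* Let $p$ be an odd prime of the form $p=2^{e}+2^{d}+1$ where $e>d$ are non-negative integers, and let $g$ be the multiplicative order of $2$ in $\mathbb{Z}_p^*$. Let $n=2^{c}+2^{b}+2^{a}$ where $c>b>a\ge 0$ are integers and $n>7$. If $\{a,b,c\}\equiv\{0,d,e\} \bmod g$ (as multisets of residues modulo $g$), then $2^{c}$, $2^{b}$ and $2^{a}$ are non-essential for $n$ in base $p$. Furthermore, at least one of the elements $7$ or $13$ is non-essential for $n$ in both base $2$ and base $p$. Hence $\Phi_{2p}$ is a factor of $Q_{n}(t)$.
   Context: For $S\subseteq[n-1]=\{1,\dots,n-1\}$ let $\beta_n(S)$ be the number of permutations $\pi\in\mathfrak{S}_n$ with descent set $\{i\in[n-1] : \pi_i>\pi_{i+1}\}$ equal to $S$. The $n$th descent set polynomial is $Q_n(t)=\sum_{S\subseteq[n-1]}t^{\beta_n(S)}$. $\Phi_m(t)$ denotes the $m$th cyclotomic polynomial; factors are in $\mathbb{Q}[t]$. For a prime $\ell$ and $1\le k\le n-1$, write $n=\sum_i n_i\ell^i$, $k=\sum_i k_i\ell^i$ with $0\le n_i,k_i<\ell$; $k$ is essential for $n$ in base $\ell$ if $k_i\le n_i$ for all $i$, and non-essential otherwise. *)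

(* Defs.v *)
From mathcomp Require Import all_boot all_order all_algebra all_fingroup all_field.

Set Implicit Arguments.
Unset Strict Implicit.
Unset Printing Implicit Defensive.

Import GRing.Theory.
Local Open Scope nat_scope.

(* Permutations of [n] act on 'I_n (0-based), so an index i : 'I_n.-1 stands   *)
(* for the element i + 1 of [n - 1], and compares 0-based positions i, i + 1.  *)
Lemma pos_hi_proof n (i : 'I_n.-1) : i.+1 < n.
Proof. by rewrite -ltn_predRL ltn_ord. Qed.

Definition pos_lo n (i : 'I_n.-1) : 'I_n := widen_ord (leq_pred n) i.
Definition pos_hi n (i : 'I_n.-1) : 'I_n := Ordinal (pos_hi_proof i).

Definition descent_set n (s : 'S_n) : {set 'I_n.-1} :=
  [set i | s (pos_hi i) < s (pos_lo i)].

Definition descent_beta n (S : {set 'I_n.-1}) : nat :=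
  #|[set s : 'S_n | descent_set s == S]|.

Definition descent_set_poly n : {poly rat} :=
  (\sum_(S : {set 'I_n.-1}) 'X^(descent_beta S))%R.

Definition digit (l m i : nat) : nat := (m %/ l ^ i) %% l.

Definition essential (l n k : nat) : Prop :=
  0 < k < n /\ forall i, digit l k i <= digit l n i.

(* The range 1 <= k <= n - 1 is part of both notions, so that non-essential    *)
(* is the negation of essential only for such k.                               *)
Definition non_essential (l n k : nat) : Prop :=
  0 < k < n /\ ~ essential l n k.

(* Main.v *)
Require Import Defs.
From mathcomp Require Import all_boot all_order all_algebra all_fingroup all_field.
From mathcomp Require Import zify.

Set Implicit Arguments.
Unset Strict Implicit.
Unset Printing Implicit Defensive.

Import GRing.Theory.
Local Open Scope nat_scope.

(* Write S + k for the symmetric difference of S and {k}. Cutting permutations *)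
(* at k gives beta_n(S) + beta_n(S + k) = C(n, k) beta_k(S') beta_{n-k}(S''),  *)
(* so toggling k negates beta_n modulo every prime dividing C(n, k). Since     *)
(* n = p = 0 mod p, this applies modulo p to every k prime to p. Modulo 2, for *)
(* n = 2^x + 2^y + 2^z and k = 2^x, the right hand side is odd exactly when S  *)
(* contains both or neither of 2^x + 2^y and 2^x + 2^z, and by pigeonhole this *)
(* holds for one of the three choices of x. Toggling that 2^x, and then 7 or   *)
(* 13, is thus an involution which preserves beta_n(S) mod p and changes its   *)
(* parity, so it negates z^beta_n(S) for z a primitive 2p-th root of unity,    *)
(* whence Q_n(z) = - Q_n(z) = 0.                                               *)

(** Modulo [p] a power of 2 depends only on its exponent modulo [g], so [n] is congruent to
    [2 ^ e + 2 ^ d + 1 = p], that is, [p] divides [n]. The lowest base-[p] digit of [n] is then 0,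
    and every [k] in range that is prime to [p] is non-essential ([non_essential_pdvd]). In base 2,
    the numbers 7 and 13 have three digits 1, as many as [n], so they are non-essential once they
    are smaller than [n]. The number 7 serves unless [p = 7], and then 13 does.

    For the factor it suffices to find an involution on the sets [S] that preserves [descent_beta]
    modulo [p] and changes its parity ([Phi_dvd_descent_set_poly]). [Phi_dvd_three_pow2] composes
    two toggles: each negates modulo [p] ([dvdn_betaD_flip]), while the one at a power of 2 changes
    the parity ([odd_betaD_flip_pow2]) and the one at 7 or 13 keeps it ([odd_beta_flip]). All of
    this rests on the cutting identity [betaD_flip]. *)

(** Modulo 2, [(1 + t) ^ (2 ^ x + m) = (1 + t ^ (2 ^ x)) (1 + t) ^ m]; compare the coefficients of
    [t ^ k]. *)
Lemma odd_bin_pow2D x m k :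
  odd 'C(2 ^ x + m, k) = odd 'C(m, k) (+) (2 ^ x <= k) && odd 'C(m, k - 2 ^ x).
Proof.
elim: x m k => [|x IHx] m k.
  case: k => [|k]; first by rewrite !bin0.
  by rewrite expn0 add1n binS oddD subn1.
rewrite expnS mul2n -addnn -addnA IHx !(IHx m) subnDA.
have -> : (2 ^ x + 2 ^ x <= k) = (2 ^ x <= k) && (2 ^ x <= k - 2 ^ x).
  by move: (2 ^ x) => y; lia.
by case: (odd _); case: (odd _); case: (odd _); case: (2 ^ x <= k); case: (2 ^ x <= _).
Qed.

Lemma odd_bin_pow2 x k : odd 'C(2 ^ x, k) = (k == 0) || (k == 2 ^ x).
Proof.
have x0 : 0 < 2 ^ x by rewrite expn_gt0.
rewrite -[2 ^ x in LHS]addn0 odd_bin_pow2D !bin0n !oddb.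
by move: (2 ^ x) x0 => y; lia.
Qed.

(** * Descent patterns and cutting a permutation in two *)

Lemma ltn_nth_enum n (x0 : 'I_n) (A : {set 'I_n}) i j : i < #|A| -> j < #|A| ->
  (nth x0 (enum A) i < nth x0 (enum A) j) = (i < j).
Proof.
have sA : sorted (fun y z : 'I_n => y < z) (enum A).
  rewrite /enum_mem -enumT; apply: sorted_filter => [? ? ?|]; first exact: ltn_trans.
  by have := iota_ltn_sorted 0 n; rewrite -val_enum_ord sorted_map.
have mono y z : y < z -> z < #|A| -> nth x0 (enum A) y < nth x0 (enum A) z.
  move=> ltyz ltz; apply: (sorted_ltn_nth _ x0 sA) => //.
  - by move=> ? ? ?; apply: ltn_trans.
  - by rewrite inE -cardE (ltn_trans ltyz).
  - by rewrite inE -cardE.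
move=> lti ltj; case: (ltngtP i j) => [lt|lt|->]; last by rewrite ltnn.
  by rewrite mono.
by apply/negbTE; rewrite -leqNgt ltnW ?mono.
Qed.

(* Only the values of P at 1, ..., n - 1 matter; the element j compares the    *)
(* 0-based positions j - 1 and j.                                              *)
Definition has_descents n (P : pred nat) (s : 'S_n) : bool :=
  [forall i : 'I_n, forall j : 'I_n, (j == i.+1 :> nat) ==> ((s j < s i) == P j)].

Definition beta n (P : pred nat) := #|[set s : 'S_n | has_descents P s]|.

Definition flip (k : nat) (P : pred nat) : pred nat := fun i => P i (+) (i == k).

Lemma has_descentsP n (P : pred nat) (s : 'S_n) :
  reflect (forall i j : 'I_n, j = i.+1 :> nat -> (s j < s i) = P j)
          (has_descents P s).
Proof.
apply: (iffP forallP) => [h i j eji | h i].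
  by move/forallP/(_ j): (h i); rewrite eji eqxx => /eqP.
by apply/forallP => j; apply/implyP => /eqP eji; apply/eqP/h.
Qed.

Lemma eq_beta n (P Q : pred nat) :
  (forall i, 0 < i < n -> P i = Q i) -> beta n P = beta n Q.
Proof.
move=> eqPQ; apply: eq_card => s; rewrite !inE.
by apply/has_descentsP/has_descentsP => h i j eji; rewrite h // ?eqPQ // eji /= -eji ltn_ord.
Qed.

Definition shuffle_fun k m (x : {set 'I_(k + m)} * 'S_k * 'S_m) (i : 'I_(k + m)) :=
  match split i with
  | inl j => nth i (enum x.1.1) (x.1.2 j)
  | inr j => nth i (enum (~: x.1.1)) (x.2 j)
  end.

(** The default [1%g] is never reached when the set has [k] elements, since [shuffle_fun] is then
    injective. *)
Definition shuffle k m (x : {set 'I_(k + m)} * 'S_k * 'S_m) : 'S_(k + m) :=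
  insubd (1%g : {perm 'I_(k + m)}) [ffun i => shuffle_fun x i].

Section Shuffle.
Variables (k m : nat) (A : {set 'I_(k + m)}) (s1 : 'S_k) (s2 : 'S_m).
Hypothesis cardA : #|A| = k.

Let cardCA : #|~: A| = m.
Proof. by apply/eqP; rewrite -(eqn_add2l #|A|) cardsC card_ord cardA. Qed.

Lemma shuffle_fun_lshift x0 (i : 'I_k) :
  shuffle_fun (A, s1, s2) (lshift m i) = nth x0 (enum A) (s1 i).
Proof.
rewrite /shuffle_fun -/(unsplit (inl i)) unsplitK /=.
by apply: set_nth_default; rewrite -cardE cardA.
Qed.

Lemma shuffle_fun_rshift x0 (i : 'I_m) :
  shuffle_fun (A, s1, s2) (rshift k i) = nth x0 (enum (~: A)) (s2 i).
Proof.
rewrite /shuffle_fun -/(unsplit (inr i)) unsplitK /=.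
by apply: set_nth_default; rewrite -cardE cardCA.
Qed.

Lemma shuffle_fun_lshift_in (i : 'I_k) : shuffle_fun (A, s1, s2) (lshift m i) \in A.
Proof.
by rewrite (shuffle_fun_lshift (lshift m i)) -mem_enum mem_nth // -cardE cardA.
Qed.

Lemma shuffle_fun_rshift_notin (i : 'I_m) :
  shuffle_fun (A, s1, s2) (rshift k i) \notin A.
Proof.
by rewrite (shuffle_fun_rshift (rshift k i)) -in_setC -mem_enum mem_nth // -cardE cardCA.
Qed.

Lemma shuffle_fun_inj : injective (shuffle_fun (A, s1, s2)).
Proof.
move=> i j; case: (split_ordP i) => i' ->; case: (split_ordP j) => j' -> eqij.
- move: eqij; rewrite !(shuffle_fun_lshift (lshift m i')) => /eqP.
  by rewrite nth_uniq ?enum_uniq -?cardE ?cardA // => /eqP/val_inj/perm_inj->.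
- by move: (shuffle_fun_lshift_in i'); rewrite eqij (negbTE (shuffle_fun_rshift_notin j')).
- by move: (shuffle_fun_lshift_in j'); rewrite -eqij (negbTE (shuffle_fun_rshift_notin i')).
move: eqij; rewrite !(shuffle_fun_rshift (rshift k i')) => /eqP.
by rewrite nth_uniq ?enum_uniq -?cardE ?cardCA // => /eqP/val_inj/perm_inj->.
Qed.

Lemma shuffleE i : shuffle (A, s1, s2) i = shuffle_fun (A, s1, s2) i.
Proof.
rewrite /shuffle -pvalE /= insubdK ?ffunE // unfold_in.
by apply/injectiveP => y z; rewrite !ffunE; apply: shuffle_fun_inj.
Qed.

Lemma ltn_shuffle_lshift (i j : 'I_k) :
  (shuffle (A, s1, s2) (lshift m i) < shuffle (A, s1, s2) (lshift m j)) = (s1 i < s1 j).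
Proof.
by rewrite !shuffleE !(shuffle_fun_lshift (lshift m i)) ltn_nth_enum ?cardA.
Qed.

Lemma ltn_shuffle_rshift (i j : 'I_m) :
  (shuffle (A, s1, s2) (rshift k i) < shuffle (A, s1, s2) (rshift k j)) = (s2 i < s2 j).
Proof.
by rewrite !shuffleE !(shuffle_fun_rshift (rshift k i)) ltn_nth_enum ?cardCA.
Qed.

Lemma shuffle_set : [set shuffle (A, s1, s2) (lshift m i) | i : 'I_k] = A.
Proof.
apply/eqP; rewrite eqEcard; apply/andP; split.
  by apply/subsetP => _ /imsetP[i _ ->]; rewrite shuffleE shuffle_fun_lshift_in.
by rewrite card_imset ?card_ord ?cardA // => i j /perm_inj/lshift_inj.
Qed.

End Shuffle.

Lemma shuffle_inj k m :
  {in [set x : {set 'I_(k + m)} * 'S_k * 'S_m | #|x.1.1| == k] &, injective (@shuffle k m)}.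
Proof.
move=> [[A s1] s2] [[B t1] t2]; rewrite !inE /= => /eqP cA /eqP cB eqst.
have eqAB : A = B by rewrite -(shuffle_set s1 s2 cA) eqst shuffle_set.
rewrite -{}eqAB {B cB} in eqst *.
have cCA : #|~: A| = m.
  by apply/eqP; rewrite -(eqn_add2l #|A|) cardsC card_ord cA.
congr (_, _, _); apply/permP => i; apply/val_inj/eqP.
  have := congr1 (fun s : 'S__ => s (lshift m i)) eqst.
  rewrite !shuffleE // !(shuffle_fun_lshift _ _ _ (lshift m i)) // => /eqP.
  by rewrite nth_uniq ?enum_uniq -?cardE ?cA.
have := congr1 (fun s : 'S__ => s (rshift k i)) eqst.
rewrite !shuffleE // !(shuffle_fun_rshift _ _ _ (rshift k i)) // => /eqP.
by rewrite nth_uniq ?enum_uniq -?cardE ?cCA.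
Qed.

Lemma card_setXX (T1 T2 T3 : finType) (A : {set T1}) (B : {set T2}) (C : {set T3}) :
  #|[set x | [&& x.1.1 \in A, x.1.2 \in B & x.2 \in C]]| = #|A| * #|B| * #|C|.
Proof.
rewrite -!cardsX; apply: eq_card => -[[x y] z]; by rewrite !inE /= andbA.
Qed.

(** By counting: [shuffle] is injective on ['C(k + m, k) * k! * m! = (k + m)!] triples, hence
    onto. *)
Lemma shuffle_surj k m (s : 'S_(k + m)) :
  exists2 x : {set 'I_(k + m)} * 'S_k * 'S_m, #|x.1.1| == k & s = shuffle x.
Proof.
set X := [set x : {set 'I_(k + m)} * 'S_k * 'S_m | #|x.1.1| == k].
suff : s \in @shuffle k m @: X by case/imsetP => x; rewrite inE => Xx ->; exists x.
suff -> : @shuffle k m @: X = setT by rewrite inE.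
apply/eqP; rewrite eqEcard subsetT cardsT card_Sn /= card_in_imset; last exact: shuffle_inj.
have -> : X = [set x | [&& x.1.1 \in [set A : {set 'I_(k + m)} | #|A| == k],
    x.1.2 \in [set: 'S_k] & x.2 \in [set: 'S_m]]].
  by apply/setP => x; rewrite !inE !andbT.
by rewrite card_setXX card_draws card_ord !cardsT !card_Sn -(bin_fact (leq_addr m k)) addKn mulnA.
Qed.

(* Cutting a permutation after position k: the set of its first k values and   *)
(* the relative orders of the two halves are arbitrary.                        *)
Lemma betaD_flip k m (P : pred nat) : 0 < k -> 0 < m ->
  beta (k + m) P + beta (k + m) (flip k P) =
  'C(k + m, k) * beta k P * beta m (fun i => P (k + i)).
Proof.
move=> k_gt0 m_gt0.
(* [Y] leaves the comparison at [k] free; splitting it by that comparison gives the two terms on the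
   left. *)
pose Y := [set s : 'S_(k + m) | [forall i : 'I_(k + m), forall j : 'I_(k + m),
  (j == i.+1 :> nat) && (j != k :> nat) ==> ((s j < s i) == P j)]].
have inY (s : 'S_(k + m)) : reflect (forall i j : 'I_(k + m), j = i.+1 :> nat ->
     j <> k :> nat -> (s j < s i) = P j) (s \in Y).
  rewrite inE; apply: (iffP forallP) => [h i j eji njk | h i].
    by move/forallP/(_ j): (h i); rewrite eji eqxx -eji /=; move/eqP: njk => -> /eqP.
  by apply/forallP => j; apply/implyP => /andP[/eqP eji /eqP njk]; apply/eqP/h.
transitivity #|Y|.
  have lt_pred : k.-1 < k + m by lia.
  have lt_k : k < k + m by lia.
  pose i0 := Ordinal lt_pred; pose j0 := Ordinal lt_k.
  have eji0 : j0 = i0.+1 :> nat by rewrite /= prednK.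
  rewrite -(cardsID [set s : 'S_(k + m) | (s j0 < s i0) == P k] Y).
  congr (_ + _); apply: eq_card => s; rewrite !inE; apply/has_descentsP/idP => [h|].
  - apply/andP; split; last by apply/eqP/h.
    by have := inY s; rewrite inE => /introT; apply=> i j eji _; apply: h.
  - case/andP => hY /eqP h0 i j eji.
    have /inY h : s \in Y by rewrite inE.
    case: (eqVneq (j : nat) k) => [ejk|/eqP]; last exact: h.
    have -> : j = j0 by apply: val_inj.
    by have -> : i = i0 by apply: val_inj => /=; lia.
  - apply/andP; split; first by rewrite (h i0 j0) //= /flip eqxx; case: (P k).
    have := inY s; rewrite inE => /introT; apply=> i j eji njk.
    by rewrite (h i j eji) /flip; move/eqP/negbTE: njk => ->; rewrite addbF.
  case/andP => h0 hY i j eji.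
  have /inY h : s \in Y by rewrite inE.
  rewrite /flip; case: (eqVneq (j : nat) k) => [ejk|/eqP njk]; last by rewrite addbF h.
  have -> : j = j0 by apply: val_inj.
  have -> : i = i0 by apply: val_inj => /=; lia.
  by move: h0; rewrite /=; case: (s j0 < s i0); case: (P k).
set Q := fun i => P (k + i).
pose X := [set x : {set 'I_(k + m)} * 'S_k * 'S_m |
  [&& x.1.1 \in [set A : {set 'I_(k + m)} | #|A| == k],
   x.1.2 \in [set s | has_descents P s] & x.2 \in [set s | has_descents Q s]]].
(* Comparisons on one side of the cut are those of [s1] or [s2]; the only adjacent pair across it is
   the one at [k], unconstrained in [Y]. *)
have -> : Y = @shuffle k m @: X.
  apply/setP => s; have [[[A s1] s2] /= /eqP cA ->] := shuffle_surj s.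
  apply/idP/imsetP => [/inY h | [x Xx ->]].
    exists (A, s1, s2) => //; rewrite !inE /= cA eqxx /=.
    apply/andP; split; apply/has_descentsP => i j eji.
      rewrite -(ltn_shuffle_lshift s1 s2 cA) h //=.
      by have := ltn_ord j; lia.
    rewrite -(ltn_shuffle_rshift s1 s2 cA) h //=; last lia.
    by rewrite eji addnS.
  case: x Xx => [[B t1] t2]; rewrite !inE /= => /and3P[/eqP cB].
  move=> /has_descentsP h1 /has_descentsP h2.
  suff : shuffle (B, t1, t2) \in Y by rewrite inE.
  apply/inY => i j.
  case: (split_ordP i) => i' ->; case: (split_ordP j) => j' -> /= eji njk.
  - by rewrite ltn_shuffle_lshift // h1.
  - by have := ltn_ord i'; lia.
  - by have := ltn_ord j'; lia.
  by rewrite ltn_shuffle_rshift // h2 //; lia.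
rewrite card_in_imset; first by rewrite card_setXX card_draws card_ord.
by move=> x y; rewrite !inE => /andP[cx _] /andP[cy _]; apply: shuffle_inj; rewrite inE.
Qed.

(** * Parity of [beta] *)

(** A permutation without descents satisfies [i <= s i] for all [i]; both sides have the same sum,
    so equality holds throughout. *)
Lemma beta_pred0 n : beta n pred0 = 1.
Proof.
rewrite /beta -(cards1 (1%g : 'S_n)); apply: eq_card => s; rewrite !inE.
apply/has_descentsP/eqP => [h | -> i j eji]; last by rewrite !perm1 eji ltnNge leqnSn.
have le_s m (i : 'I_n) : i = m :> nat -> i <= s i.
  elim: m i => [|m IHm] i eim; first by rewrite eim.
  have lt_m : m < n by rewrite ltnW // -eim.
  have le_sm := IHm (Ordinal lt_m) erefl.
  have /negbT := h (Ordinal lt_m) i eim; rewrite -leqNgt leq_eqVlt val_eqE.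
  rewrite (inj_eq perm_inj) -val_eqE /= eim ltn_eqF //=.
  exact: leq_ltn_trans.
have [_] : \sum_(i < n) i <= \sum_(i < n) s i ?= iff [forall i : 'I_n, i == s i].
  by apply: leqif_sum => i _; split; [exact: le_s erefl | rewrite val_eqE].
have -> : \sum_(i < n) s i = \sum_(i < n) i.
  exact/esym/(reindex_inj (F := fun i : 'I_n => i : nat) (@perm_inj _ s)).
rewrite eqxx => /esym/forallP es.
by apply/permP => i; rewrite perm1 -(eqP (es i)).
Qed.

Lemma odd_beta_flip n k (P : pred nat) : 0 < k < n -> ~~ odd 'C(n, k) ->
  odd (beta n (flip k P)) = odd (beta n P).
Proof.
case/andP=> k_gt0 lt_kn even_C.
have := betaD_flip P k_gt0 (m := n - k); rewrite subn_gt0 subnKC ?(ltnW lt_kn) //.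
move=> /(_ lt_kn) /(congr1 odd); rewrite !oddM (negbTE even_C) /= oddD.
by case: (odd _); case: (odd _).
Qed.

Lemma odd_beta_restrict n (P : pred nat) :
  odd (beta n P) = odd (beta n (fun i => P i && odd 'C(n, i))).
Proof.
(* [Q j] drops from [P] the elements below [j] with even binomial; passing from [j] to [j.+1]
   toggles at most [j], at no cost to the parity. *)
pose Q j i := P i && ((i < j) ==> odd 'C(n, i)).
have -> : odd (beta n P) = odd (beta n (Q 0)).
  by congr (odd _); apply: eq_beta => i _; rewrite /Q andbT.
have -> : beta n (fun i => P i && odd 'C(n, i)) = beta n (Q n).
  by apply: eq_beta => i /andP[_ lt_in]; rewrite /Q lt_in.
suff eqQ j : odd (beta n (Q 0)) = odd (beta n (Q j)) by exact: eqQ.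
elim: j => // j ->.
have [PCj|] := boolP [&& P j, 0 < j < n & ~~ odd 'C(n, j)].
  case/and3P: PCj => Pj lt_j evenC; rewrite -(odd_beta_flip _ lt_j evenC).
  congr (odd _); apply: eq_beta => i _; rewrite /flip /Q ltnS (leq_eqVlt i j).
  by case: (eqVneq i j) => [->|_] /=; rewrite ?ltnn ?Pj ?(negbTE evenC) ?addbF.
move=> nPCj; congr (odd _); apply: eq_beta => i lt_i; rewrite /Q ltnS (leq_eqVlt i j).
case: (eqVneq i j) => [eij|//]; rewrite -{}eij lt_i /= ltnn andbT in nPCj *.
by case: (P i) nPCj => //=; rewrite negbK => ->.
Qed.

Lemma odd_beta_pow2 x (P : pred nat) : odd (beta (2 ^ x) P).
Proof.
rewrite odd_beta_restrict (@eq_beta _ _ pred0) ?beta_pred0 // => i /andP[i_gt0 lt_i].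
by rewrite odd_bin_pow2 (gtn_eqF i_gt0) (ltn_eqF lt_i) andbF.
Qed.

Lemma odd_bin_pow2D2 y z k : y < z ->
  odd 'C(2 ^ y + 2 ^ z, k) = (k \in [:: 0; 2 ^ y; 2 ^ z; 2 ^ y + 2 ^ z]).
Proof.
move=> lt_yz; have lt2 : 2 ^ y < 2 ^ z by rewrite ltn_exp2l.
rewrite odd_bin_pow2D !odd_bin_pow2 !inE.
have : 0 < 2 ^ y by rewrite expn_gt0.
by move: (2 ^ y) (2 ^ z) lt2 => Y Z; lia.
Qed.

(** Only membership of [2 ^ y] and [2 ^ z] matters. Toggling either changes the parity, because the
    right-hand side of [betaD_flip] is then a product of odd numbers, and the empty set gives 1. *)
Lemma odd_beta_pow2D2 y z (P : pred nat) : y != z ->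
  odd (beta (2 ^ y + 2 ^ z) P) = (P (2 ^ y) == P (2 ^ z)).
Proof.
wlog lt_yz : y z / y < z.
  move=> wl; case: (ltngtP y z) => // lt_yz _; first exact: wl lt_yz (negbT (ltn_eqF lt_yz)).
  by rewrite addnC eq_sym; apply: wl lt_yz (negbT (ltn_eqF lt_yz)).
move=> _; have lt2 : 2 ^ y < 2 ^ z by rewrite ltn_exp2l.
have y_gt0 : 0 < 2 ^ y by rewrite expn_gt0.
have z_gt0 : 0 < 2 ^ z by rewrite expn_gt0.
have odd_flip_y Q : odd (beta (2 ^ y + 2 ^ z) (flip (2 ^ y) Q)) =
    ~~ odd (beta (2 ^ y + 2 ^ z) Q).
  have /(congr1 odd) := betaD_flip Q y_gt0 z_gt0.
  rewrite !oddM !odd_beta_pow2 odd_bin_pow2D2 // !inE eqxx orbT /= oddD.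
  by case: (odd _); case: (odd _).
have odd_flip_z Q : odd (beta (2 ^ y + 2 ^ z) (flip (2 ^ z) Q)) =
    ~~ odd (beta (2 ^ y + 2 ^ z) Q).
  have /(congr1 odd) := betaD_flip Q z_gt0 y_gt0.
  rewrite ![2 ^ z + _]addnC !oddM !odd_beta_pow2 odd_bin_pow2D2 // !inE eqxx !orbT /= oddD.
  by case: (odd _); case: (odd _).
have odd0 : odd (beta (2 ^ y + 2 ^ z) pred0) by rewrite beta_pred0.
pose Q := (if P (2 ^ y) then flip (2 ^ y) else id)
  ((if P (2 ^ z) then flip (2 ^ z) else id) pred0).
rewrite odd_beta_restrict (@eq_beta _ _ Q) => [|i /andP[i_gt0 lt_i]].
  rewrite /Q; case: (P (2 ^ y)); case: (P (2 ^ z)).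
  - by rewrite odd_flip_y odd_flip_z odd0.
  - by rewrite odd_flip_y odd0.
  - by rewrite odd_flip_z odd0.
  by rewrite odd0.
rewrite odd_bin_pow2D2 // !inE (gtn_eqF i_gt0) (ltn_eqF lt_i) orbF /Q /flip /=.
have ne_yz := ltn_eqF lt2; have ne_zy := gtn_eqF lt2.
case: (eqVneq i (2 ^ y)) => [->|ny]; first by case: (P (2 ^ y)); case: (P (2 ^ z)); rewrite /= ?eqxx ?ne_yz.
case: (eqVneq i (2 ^ z)) => [->|nz]; first by case: (P (2 ^ y)); case: (P (2 ^ z)); rewrite /= ?eqxx ?ne_zy.
by rewrite andbF; case: (P (2 ^ y)); case: (P (2 ^ z)); rewrite /= ?(negbTE ny) ?(negbTE nz).
Qed.

Lemma odd_bin_pow2D3 a b c k : a < b -> b < c ->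
  odd 'C(2 ^ c + 2 ^ b + 2 ^ a, k) =
  (k \in [:: 0; 2 ^ a; 2 ^ b; 2 ^ a + 2 ^ b; 2 ^ c; 2 ^ c + 2 ^ a; 2 ^ c + 2 ^ b;
             2 ^ c + 2 ^ b + 2 ^ a]).
Proof.
move=> lt_ab lt_bc; rewrite -addnA (addnC (2 ^ b)) odd_bin_pow2D !odd_bin_pow2D2 // !inE.
have lt2 : 2 ^ a < 2 ^ b by rewrite ltn_exp2l.
have le2 : 2 * 2 ^ b <= 2 ^ c by rewrite -expnS leq_exp2l.
have : 0 < 2 ^ a by rewrite expn_gt0.
move: (2 ^ a) (2 ^ b) (2 ^ c) lt2 le2 => A B C lt2 le2 A_gt0.
case: (leqP C k) => [le_Ck | lt_kC]; last by rewrite addbF; lia.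
have -> : [|| k == 0, k == A, k == B | k == A + B] = false by lia.
by rewrite /=; lia.
Qed.

Lemma odd_betaD_flip_pow2 x y z n (P : pred nat) : y != z ->
    n = 2 ^ x + (2 ^ y + 2 ^ z) -> odd 'C(n, 2 ^ x) ->
  odd (beta n P + beta n (flip (2 ^ x) P)) = (P (2 ^ x + 2 ^ y) == P (2 ^ x + 2 ^ z)).
Proof.
move=> ne_yz -> oddC.
rewrite betaD_flip ?addn_gt0 ?expn_gt0 // !oddM oddC odd_beta_pow2.
exact: odd_beta_pow2D2.
Qed.

(** * Toggling modulo an odd or even prime, and the return to sets *)

(** From [k * 'C(n, k) = n * 'C(n.-1, k.-1)]. *)
Lemma dvdn_bin p n k : prime p -> p %| n -> ~~ (p %| k) -> p %| 'C(n, k).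
Proof.
case: n k => [|n] [|k] pr_p pn pk; rewrite ?dvdn0 // in pk *.
by have := mul_bin_diag n.+1 k; rewrite -(Gauss_dvdr _ (_ : coprime p k.+1)) ?prime_coprime // => <-;
  apply: dvdn_mulr.
Qed.

Lemma dvdn_betaD_flip p n k (P : pred nat) : prime p -> p %| n -> ~~ (p %| k) -> k < n ->
  p %| beta n P + beta n (flip k P).
Proof.
move=> pr_p pn pk lt_kn; have k_gt0 : 0 < k by case: k pk {lt_kn}; rewrite ?dvdn0.
have := betaD_flip P k_gt0 (m := n - k); rewrite subn_gt0 subnKC ?(ltnW lt_kn) // => -> //.
by rewrite -mulnA dvdn_mulr ?dvdn_bin.
Qed.

Definition elements n (S : {set 'I_n.-1}) : pred nat :=
  fun i => [exists j in S, j.+1 == i].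

Lemma elementsE n (S : {set 'I_n.-1}) (j : 'I_n.-1) : elements S j.+1 = (j \in S).
Proof.
apply/exists_inP/idP => [[i Si /eqP[/val_inj <-]]//|Sj]; by exists j.
Qed.

Lemma descent_betaE n (S : {set 'I_n.-1}) : descent_beta S = beta n (elements S).
Proof.
apply: eq_card => s; rewrite !inE; apply/eqP/has_descentsP => [<- i j eji | h].
  have lt_i : i < n.-1 by rewrite ltn_predRL -eji.
  rewrite eji (elementsE _ (Ordinal lt_i)) inE; congr (s _ < s _); exact: val_inj.
by apply/setP => i; rewrite inE (h (pos_lo i)) // elementsE.
Qed.

Definition toggle n k (S : {set 'I_n.-1}) : {set 'I_n.-1} :=
  [set i | (i \in S) (+) (i.+1 == k)].

Lemma toggleK n k : involutive (@toggle n k).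
Proof. by move=> S; apply/setP => i; rewrite !inE -addbA addbb addbF. Qed.

Lemma toggleC n k l (S : {set 'I_n.-1}) : toggle k (toggle l S) = toggle l (toggle k S).
Proof. by apply/setP => i; rewrite !inE addbAC. Qed.

Lemma elements_toggle n k (S : {set 'I_n.-1}) i : 0 < i < n ->
  elements (toggle k S) i = flip k (elements S) i.
Proof.
case: i => // i /=; rewrite -ltn_predRL => lt_i.
by rewrite /flip !(elementsE _ (Ordinal lt_i)) inE.
Qed.

Lemma descent_beta_toggle n k (S : {set 'I_n.-1}) :
  descent_beta (toggle k S) = beta n (flip k (elements S)).
Proof. by rewrite descent_betaE; apply: eq_beta => i; apply: elements_toggle. Qed.

(** * Roots of unity and cyclotomic factors *)

Lemma expr_prim_root_addp (z : algC) p x y : odd p -> ((2 * p).-primitive_root z)%R ->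
  x = y %[mod p] -> odd x != odd y -> (z ^+ x = - z ^+ y)%R.
Proof.
move=> odd_p prim_z eq_xy odd_xy.
have co2p : coprime 2 p by rewrite coprime2n.
have zp : (z ^+ p = -1)%R.
  have : (z ^+ p != 1)%R.
    rewrite -(prim_order_dvd prim_z); apply/negP => /dvdn_leq; case: (p) odd_p => // m _ /(_ isT).
    by rewrite mul2n -addnn addSn ltnNge leq_addl.
  have : ((z ^+ p) ^+ 2 == 1)%R by rewrite -exprM mulnC prim_expr_order.
  by rewrite sqrf_eq1 => /orP[->//|/eqP].
(* With [-1 = z ^+ p] the claim becomes [x = p + y] modulo [2 * p], which is checked modulo 2 and
   modulo [p]. *)
rewrite -mulN1r -zp -exprD; apply/eqP; rewrite (eq_prim_root_expr prim_z).
rewrite chinese_remainder // !modn2 oddD odd_p modnDl; apply/andP; split; last exact/eqP.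
by case: (odd x) odd_xy; case: (odd y).
Qed.

(** The cyclotomic polynomial is the minimal polynomial of [z] over the rationals. *)
Lemma Phi_dvd_of_root n (q : {poly rat}) (z : algC) : (n.-primitive_root z)%R ->
  root (map_poly ratr q) z -> (map_poly intr 'Phi_n %| q)%R.
Proof.
move=> prim_z; have [r [min_r _] ->] := minCpolyP z.
suff -> : r = map_poly intr 'Phi_n by [].
apply: (map_inj_poly (fmorph_inj (ratr : {rmorphism rat -> algC}))); first exact: rmorph0.
rewrite -min_r (minCpoly_cyclotomic prim_z) -(Cintr_Cyclotomic prim_z) -map_poly_comp.
by apply: eq_map_poly => i /=; rewrite ratr_int.
Qed.

Lemma Phi_dvd_descent_set_poly n p (f : {set 'I_n.-1} -> {set 'I_n.-1}) :
    odd p -> involutive f ->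
    (forall S, descent_beta (f S) = descent_beta S %[mod p]) ->
    (forall S, odd (descent_beta (f S)) != odd (descent_beta S)) ->
  (map_poly intr 'Phi_(2 * p) %| descent_set_poly n)%R.
Proof.
move=> odd_p fK eq_p ne_2.
have p2_gt0 : 0 < 2 * p by rewrite muln_gt0 /= odd_gt0.
have [z prim_z] := C_prim_root_exists p2_gt0.
apply: (Phi_dvd_of_root prim_z); rewrite /root /descent_set_poly rmorph_sum horner_sum /=.
set s := (\sum_S _)%R.
have sE : s = (\sum_(S : {set 'I_n.-1}) z ^+ descent_beta S)%R.
  by apply: eq_bigr => S _; rewrite map_polyXn hornerXn.
suff : s = (- s)%R by move/eqP; rewrite -addr_eq0 -mulr2n -mulr_natl mulf_eq0 Num.Theory.pnatr_eq0.
rewrite {1}sE (reindex_inj (inv_inj fK)) sE -sumrN; apply: eq_bigr => S _ /=.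
exact: expr_prim_root_addp odd_p prim_z (eq_p S) (ne_2 S).
Qed.

(** * The involution for a sum of three powers of 2 *)

(** The power of 2 to toggle depends on [S], but only through the three sums of two of the powers.
    Neither toggle touches such a sum, so the same power is chosen for [f S], and [f] is an
    involution. *)
Lemma Phi_dvd_three_pow2 a b c n p k : prime p -> odd p -> a < b -> b < c ->
    n = 2 ^ c + 2 ^ b + 2 ^ a -> p %| n ->
    0 < k < n -> ~~ odd 'C(n, k) -> ~~ (p %| k) ->
  (map_poly intr 'Phi_(2 * p) %| descent_set_poly n)%R.
Proof.
move=> pr_p odd_p lt_ab lt_bc n_def pn lt_k even_k pNk.
have a_gt0 : 0 < 2 ^ a by rewrite expn_gt0.
have b_gt0 : 0 < 2 ^ b by rewrite expn_gt0.
have c_gt0 : 0 < 2 ^ c by rewrite expn_gt0.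
have lt_ab2 : 2 ^ a < 2 ^ b by rewrite ltn_exp2l.
have lt_bc2 : 2 ^ b < 2 ^ c by rewrite ltn_exp2l.
pose ab (S : {set 'I_n.-1}) := elements S (2 ^ a + 2 ^ b) : bool.
pose ac (S : {set 'I_n.-1}) := elements S (2 ^ a + 2 ^ c) : bool.
pose bc (S : {set 'I_n.-1}) := elements S (2 ^ b + 2 ^ c) : bool.
(* Two of the three sums lie both inside or both outside S: v S is the power   *)
(* of 2 which they share.                                                      *)
pose v (S : {set 'I_n.-1}) := 2 ^ (if ab S == ac S then a else if ab S == bc S then b else c).
pose f (S : {set 'I_n.-1}) := toggle k (toggle (v S) S).
have odd_n i : odd 'C(n, i) = (i \in [:: 0; 2 ^ a; 2 ^ b; 2 ^ a + 2 ^ b; 2 ^ c;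
    2 ^ c + 2 ^ a; 2 ^ c + 2 ^ b; 2 ^ c + 2 ^ b + 2 ^ a]).
  by rewrite n_def odd_bin_pow2D3.
have v_lt S : v S < n.
  by rewrite /v n_def; case: ifP => _; [|case: ifP => _]; lia.
have v_odd S : odd (descent_beta S + descent_beta (toggle (v S) S)).
  rewrite descent_beta_toggle descent_betaE /v; case: ifP => [eq_abc|ne_abc].
    rewrite (odd_betaD_flip_pow2 _ (y := b) (z := c)) ?odd_n ?inE ?eqxx ?orbT //.
    - by rewrite ltn_eqF.
    by rewrite n_def; lia.
  case: ifP => [eq_abc|ne_abc2].
    rewrite (odd_betaD_flip_pow2 _ (y := a) (z := c)) ?odd_n ?inE ?eqxx ?orbT //.
    - by rewrite (addnC (2 ^ b)).
    - by rewrite ltn_eqF // (ltn_trans lt_ab).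
    by rewrite n_def; lia.
  rewrite (odd_betaD_flip_pow2 _ (y := a) (z := b)) ?odd_n ?inE ?eqxx ?orbT //.
  - move: ne_abc ne_abc2; rewrite /ab /ac /bc ![2 ^ c + _]addnC.
    by do 3!case: (elements S _).
  - by rewrite ltn_eqF.
  by rewrite n_def; lia.
have pNv S : ~~ (p %| v S).
  by rewrite /v Euclid_dvdX // (gtnNdvd _ (odd_prime_gt2 odd_p pr_p)).
(* This covers the three sums: their binomials are odd, while ['C(n, k)] is even. *)
have nek (S : {set 'I_n.-1}) i : odd 'C(n, i) -> 0 < i < n -> elements (toggle k S) i = elements S i.
  move=> odd_i lt_i; have ne_ik : i != k by apply: contraTneq odd_i => ->.
  by rewrite elements_toggle // /flip (negbTE ne_ik) addbF.
have nev x (S : {set 'I_n.-1}) i : i != 2 ^ x -> 0 < i < n -> elements (toggle (2 ^ x) S) i = elements S i.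
  by move=> ne_i lt_i; rewrite elements_toggle // /flip (negbTE ne_i) addbF.
have sum_ne x y z : x < y -> 2 ^ x + 2 ^ y != 2 ^ z.
  move=> lt_xy; have lt2 : 2 ^ x < 2 ^ y by rewrite ltn_exp2l.
  have x_gt0 : 0 < 2 ^ x by rewrite expn_gt0.
  case: (ltnP y z) => [lt_yz | le_zy].
    have : 2 * 2 ^ y <= 2 ^ z by rewrite -expnS leq_exp2l.
    by lia.
  have : 2 ^ z <= 2 ^ y by rewrite leq_exp2l.
  by lia.
have fE x y (S : {set 'I_n.-1}) : x < y -> odd 'C(n, 2 ^ x + 2 ^ y) -> 0 < 2 ^ x + 2 ^ y < n ->
    elements (f S) (2 ^ x + 2 ^ y) = elements S (2 ^ x + 2 ^ y).
  by move=> lt_xy odd_xy lt_xyn; rewrite /f nek // nev // sum_ne.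
have abf S : ab (f S) = ab S.
  by apply: fE => //; [rewrite odd_n !inE eqxx !orbT | rewrite n_def; lia].
have acf S : ac (f S) = ac S.
  apply: fE; [exact: ltn_trans lt_bc|rewrite odd_n addnC !inE eqxx !orbT // | rewrite n_def; lia].
have bcf S : bc (f S) = bc S.
  by apply: fE => //; [rewrite odd_n addnC !inE eqxx !orbT | rewrite n_def; lia].
have vf S : v (f S) = v S by rewrite /v abf acf bcf.
apply: (Phi_dvd_descent_set_poly (f := f)) => // [S|S|S].
- have fS T : f T = toggle k (toggle (v T) T) by [].
  by rewrite fS vf fS (toggleC (v S) k) !toggleK.
- have := dvdn_betaD_flip (elements S) pr_p pn (pNv S) (v_lt S).
  have := dvdn_betaD_flip (elements (toggle (v S) S)) pr_p pn pNk (proj2 (andP lt_k)).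
  rewrite -!descent_beta_toggle -!descent_betaE -/(f S) => d1 d2.
  (* The two negations cancel: after adding the intermediate value, both sides are 0 modulo [p]. *)
  apply/eqP; rewrite -(eqn_modDl (descent_beta (toggle (v S) S))).
  by rewrite [X in X == _](eqP d1) addnC (eqP d2).
have -> : odd (descent_beta (f S)) = odd (descent_beta (toggle (v S) S)).
  by rewrite /f descent_beta_toggle odd_beta_flip // -descent_betaE.
have := v_odd S; rewrite oddD.
by case: (odd _); case: (odd _).
Qed.

(** * Non-essential elements and the conclusion *)

Lemma non_essential_pdvd p n k : p %| n -> ~~ (p %| k) -> 0 < k < n -> non_essential p n k.
Proof.
move=> pn pNk lt_k; split=> // -[_ /(_ 0)]; rewrite /digit !divn1.
by rewrite (eqP pn) leqn0; apply/negP.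
Qed.

Lemma expn_modz_order p (u : {unit 'Z_p}) x : 1 < p -> FinRing.uval u = (2%:R)%R ->
  2 ^ x = 2 ^ (x %% #[u]%g) %[mod p].
Proof.
move=> p_gt1 u_def.
rewrite -!(val_Zp_nat p_gt1) !natrX -u_def -!FinRing.val_unitX.
by rewrite -(expg_mod_order u x).
Qed.

(** Since 7 and 13 are below 16, only the four lowest binary digits of [n] need a case analysis. *)
Lemma expn2_small x :
  [\/ [\/ 2 ^ x = 1, 2 ^ x = 2 | 2 ^ x = 4], 2 ^ x = 8
    | exists2 q, 0 < q & 2 ^ x = 16 * q].
Proof.
case: x => [|[|[|[|x]]]]; try by [constructor 1; constructor | constructor 2].
by constructor 3; exists (2 ^ x); rewrite ?expn_gt0 // !expnS !mulnA.
Qed.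

Section ThreePowersOf2.
Variables a b c n : nat.
Hypotheses (lt_ab : a < b) (lt_bc : b < c) (n_def : n = 2 ^ c + 2 ^ b + 2 ^ a).

Let lt_ab2 : 2 ^ a < 2 ^ b. Proof. by rewrite ltn_exp2l. Qed.
Let lt_bc2 : 2 ^ b < 2 ^ c. Proof. by rewrite ltn_exp2l. Qed.

(** As [7 = 1 + 2 + 4], being essential would force [n = 7]. For 13 below, use [13 = 1 + 4 + 8]. *)
Lemma non_essential2_7 : 7 < n -> non_essential 2 n 7 /\ ~~ odd 'C(n, 7).
Proof.
move=> n_gt7; split.
  split=> // -[_ ess].
  have := ess 0; have := ess 1; have := ess 2.
  rewrite /digit expn0 expn1 -[2 ^ 2]/4 => ess2 ess1 ess0.
  case: (expn2_small a) => [[] ea|ea|[qa qa0 ea]];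
  case: (expn2_small b) => [[] eb|eb|[qb qb0 eb]];
  case: (expn2_small c) => [[] ec|ec|[qc qc0 ec]]; lia.
rewrite n_def odd_bin_pow2D3 // !inE.
  case: (expn2_small a) => [[] ea|ea|[qa qa0 ea]];
  case: (expn2_small b) => [[] eb|eb|[qb qb0 eb]];
  case: (expn2_small c) => [[] ec|ec|[qc qc0 ec]]; lia.
Qed.

Lemma non_essential2_13 : 13 < n -> non_essential 2 n 13 /\ ~~ odd 'C(n, 13).
Proof.
move=> n_gt13; split.
  split=> // -[_ ess].
  have := ess 0; have := ess 2; have := ess 3.
  rewrite /digit expn0 -[2 ^ 2]/4 -[2 ^ 3]/8 => ess3 ess2 ess0.
  case: (expn2_small a) => [[] ea|ea|[qa qa0 ea]];
  case: (expn2_small b) => [[] eb|eb|[qb qb0 eb]];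
  case: (expn2_small c) => [[] ec|ec|[qc qc0 ec]]; lia.
rewrite n_def odd_bin_pow2D3 // !inE.
  case: (expn2_small a) => [[] ea|ea|[qa qa0 ea]];
  case: (expn2_small b) => [[] eb|eb|[qb qb0 eb]];
  case: (expn2_small c) => [[] ec|ec|[qc qc0 ec]]; lia.
Qed.

End ThreePowersOf2.

Theorem theorem6p7 (p d e g a b c n : nat) (u : {unit 'Z_p})
  (p_prime : prime p) (p_odd : odd p)
  (lt_de : (d < e)%N) (p_def : p = (2 ^ e + 2 ^ d + 1)%N)
  (u_def : FinRing.uval u = (2%:R)%R) (g_def : g = #[u]%g)
  (lt_ab : (a < b)%N) (lt_bc : (b < c)%N)
  (n_def : n = (2 ^ c + 2 ^ b + 2 ^ a)%N) (n_gt7 : (7 < n)%N)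
  (abc_mod_g : perm_eq [:: (a %% g)%N; (b %% g)%N; (c %% g)%N]
                       [:: (0 %% g)%N; (d %% g)%N; (e %% g)%N]) :
  [/\ [/\ non_essential p n (2 ^ c), non_essential p n (2 ^ b)
        & non_essential p n (2 ^ a)],
      (non_essential 2 n 7 /\ non_essential p n 7) \/
      (non_essential 2 n 13 /\ non_essential p n 13)
    & (map_poly intr 'Phi_(2 * p) %| descent_set_poly n)%R].
Proof.
have p_gt1 := prime_gt1 p_prime.
(* Oddness of [p] excludes [d = 0], so [p] is at least [4 + 2 + 1]. *)
have p_ge7 : 7 <= p.
  case: (expn2_small d) (expn2_small e) => [[] ed|ed|[qd qd0 ed]] [[] ee|ee|[qe qe0 ee]];
  by have : 2 ^ d < 2 ^ e by [rewrite ltn_exp2l]; lia.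
(* Reducing exponents modulo [g] turns both [n] and [p] into the same sum of powers, up to order. *)
have pn : p %| n.
  have mod_sumn s : sumn [seq 2 ^ i | i <- s] =
      sumn [seq 2 ^ i | i <- [seq i %% g | i <- s]] %[mod p].
    elim: s => //= x s IHs; rewrite -modnDm IHs (expn_modz_order x p_gt1 u_def).
    by rewrite -g_def modnDm.
  have n_sum : n = sumn [seq 2 ^ i | i <- [:: a; b; c]] by rewrite n_def /=; lia.
  have p_sum : sumn [seq 2 ^ i | i <- [:: 0; d; e]] = p by rewrite p_def /=; lia.
  have /= eq_sum := perm_sumn (perm_map (fun i => 2 ^ i) abc_mod_g).
  have := mod_sumn [:: 0; d; e]; rewrite p_sum modnn /= -eq_sum => mod0.
  by rewrite /dvdn n_sum mod_sumn /= -mod0.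
have pN2 x : ~~ (p %| 2 ^ x).
  by rewrite Euclid_dvdX // (gtnNdvd _ (odd_prime_gt2 p_odd p_prime)).
have gt0 x : 0 < 2 ^ x by rewrite expn_gt0.
split.
- by split; apply: non_essential_pdvd => //; have := gt0 a; have := gt0 b; have := gt0 c; lia.
- have [p7|p_ne7] := eqVneq p 7; last first.
    left; have [ne2_7 _] := non_essential2_7 lt_ab lt_bc n_def n_gt7; split=> //.
    by apply: non_essential_pdvd; rewrite // gtnNdvd //; lia.
  (* A multiple of 7 larger than 7 is at least 14. *)
  right; have n_gt13 : 13 < n by move: pn; rewrite p7 => /dvdnP[q n_eq]; lia.
  have [ne2_13 _] := non_essential2_13 lt_ab lt_bc n_def n_gt13; split=> //.
  by apply: non_essential_pdvd; rewrite // p7.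
have [p7|p_ne7] := eqVneq p 7; last first.
  have [_ even_7] := non_essential2_7 lt_ab lt_bc n_def n_gt7.
  by apply: (Phi_dvd_three_pow2 _ _ lt_ab lt_bc n_def pn _ even_7); rewrite // gtnNdvd //; lia.
have n_gt13 : 13 < n by move: pn; rewrite p7 => /dvdnP[q n_eq]; lia.
have [_ even_13] := non_essential2_13 lt_ab lt_bc n_def n_gt13.
by apply: (Phi_dvd_three_pow2 _ _ lt_ab lt_bc n_def pn _ even_13); rewrite // p7.
Qed.
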